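(* Suppose $p$ is an odd prime and $D\in\mathbb{Z}[\frac1p]$ with $0<D<1$. There are finitely many points $P_1,\ldots,P_N\in S_{000D}(\mathbb{Z}[\frac1p])$ such that every other $\mathbb{Z}[\frac1p]$-point in the compact part of $S_{000D}(\mathbb{R})$ is either (i) on the $\Gamma_{000D}$-orbit of some $P_i$, or (ii) on the $\Gamma_{000D}$-orbit of some point in the set $$\left\{(X_1,X_2,X_3)\in S_{000D}(\mathbb{Z}[\tfrac1p]) : X_1X_2X_3=0 \text{ and there exists } i \text{ with } 2\,\mathrm{val}_p(X_i)<\mathrm{val}_p(D)\right\}.$$ Moreover, if $p\equiv1\pmod 4$ and there are $x_0,y_0\in\mathbb{Z}[\frac1p]$ with $x_0^2+y_0^2=D$, then the set in (ii) is infinite. Otherwise, the set in (ii) is empty.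
   Context: $S_{000D}$ is the surface $X_1^2+X_2^2+X_3^2+X_1X_2X_3=D$. $\Gamma_{000D}$ is the group generated by the Vieta involutions $s_1(X_1,X_2,X_3)=(-X_1-X_2X_3,X_2,X_3)$, $s_2(X_1,X_2,X_3)=(X_1,-X_2-X_1X_3,X_3)$, $s_3(X_1,X_2,X_3)=(X_1,X_2,-X_3-X_1X_2)$. For real $0<D<4$, the real surface $S_{000D}(\mathbb{R})\subset\mathbb{R}^3$ has a unique compact connected component, called its compact part. $\mathrm{val}_p$ is the $p$-adic valuation, with $\mathrm{val}_p(0)=\infty$. *)

(* Defs.v *)
From mathcomp Require Import all_boot all_order all_algebra.
From mathcomp Require Import all_classical all_reals all_analysis.

Set Implicit Arguments.
Unset Strict Implicit.
Unset Printing Implicit Defensive.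

Import Order.TTheory GRing.Theory Num.Theory.
Import numFieldNormedType.Exports.

Local Open Scope classical_set_scope.
Local Open Scope ring_scope.

Definition surface (A : comNzRingType) (D : A) : set 'rV[A]_3 :=
  [set X | \sum_i X 0 i ^+ 2 + \prod_i X 0 i = D].

Definition vieta (A : comNzRingType) (i : 'I_3) (X : 'rV[A]_3) : 'rV[A]_3 :=
  \row_j (if j == i then - X 0 i - \prod_(k | k != i) X 0 k else X 0 j).

(* Subgroup of the bijections of A^3 generated by the [vieta i]; the two [cancel]
   hypotheses say that h is the inverse of g. *)
Inductive Gamma (A : comNzRingType) : ('rV[A]_3 -> 'rV[A]_3) -> Prop :=
| Gamma_vieta i : Gamma (@vieta A i)
| Gamma_id : Gamma id
| Gamma_comp g h : Gamma g -> Gamma h -> Gamma (g \o h)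
| Gamma_inv g h : Gamma g -> cancel g h -> cancel h g -> Gamma h.

Definition Gamma_orbit (A : comNzRingType) (P : 'rV[A]_3) : set 'rV[A]_3 :=
  [set Q | exists2 g, Gamma g & Q = g P].

(* Z[1/p], as a subset of the rationals. *)
Definition Zinv (p : nat) : set rat :=
  [set x | exists n : nat, x * p%:R ^+ n \is a Num.int].

Definition surface_Zinv (p : nat) (D : rat) : set 'rV[rat]_3 :=
  [set X | surface D X /\ forall i, Zinv p (X 0 i)].

Definition valp (p : nat) (x : rat) : \bar int :=
  if x == 0 then +oo%E
  else ((logn p `|numq x|)%:Z - (logn p `|denq x|)%:Z)%:E.

(* The union of the compact connected components of the real surface; for
   0 < D < 4 there is exactly one such component. *)
Definition compact_part (R : realType) (D : R) : set 'rV[R]_3 :=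
  [set X | surface D X /\ compact (connected_component (surface D) X)].

Definition exceptional_set (p : nat) (D : rat) : set 'rV[rat]_3 :=
  [set X | [/\ surface_Zinv p D X, \prod_i X 0 i = 0 &
               exists i, (2%R%:E * valp p (X 0%R i) < valp p D)%E]].

(* Main.v *)
Require Import Defs.
From mathcomp Require Import all_boot all_order all_algebra.
From mathcomp Require Import finfield algC algnum.
From mathcomp Require Import zify ring lra.
From mathcomp Require Import all_classical all_reals all_analysis.

Set Implicit Arguments.
Unset Strict Implicit.
Unset Printing Implicit Defensive.

Import Order.TTheory GRing.Theory Num.Theory.
Import numFieldNormedType.Exports.

Local Open Scope classical_set_scope.
Local Open Scope ring_scope.

(** Let X be a Z[1/p]-point of the compact part. There |X_i| < 2, and positivity
    of the binary quadratic forms y^2 + xyz + z^2 (|x| < 2) sharpens this to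
    X_i^2 <= D < 1, so a p-integral coordinate vanishes. If some val_p(X_i) is
    smaller than val_p(D)/2 and is the strict minimum, the Vieta move s_i raises
    it because X_i X_i' = X_j^2 + X_k^2 - D; if it is attained twice, the
    equation forces the third coordinate to be p-integral, hence zero, and X is
    exceptional. The descent stops at points with 2 val_p(X_i) >= val_p(D), and
    these have bounded denominators and bounded size.

    An exceptional point is (x, y, 0) up to order, with x^2 + y^2 = D and
    val_p(x^2) < val_p(x^2 + y^2), so -1 is a square mod p. Conversely, for
    p = 1 mod 4 write p = a^2 + b^2: multiplying x + iy by powers of
    (a + ib)/(a - ib), which is not a root of unity, gives infinitely many
    points, all but finitely many of them exceptional. *)

(** * p-adic valuation of rational numbers *)

(** Agrees with [valp] away from zero, but takes values in [int], where linear arithmetic is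
    available. *)
Definition vq (p : nat) (x : rat) : int :=
  (logn p `|numq x|)%:Z - (logn p `|denq x|)%:Z.

Lemma vq_frac p (a b : int) : a != 0 -> b != 0 ->
  vq p (a%:~R / b%:~R) = (logn p `|a|)%:Z - (logn p `|b|)%:Z.
Proof.
move=> a0 b0; rewrite /vq; set x : rat := _ / _.
have xE : x = (numq x)%:~R / (denq x)%:~R by rewrite divq_num_den.
have x0 : x != 0 by rewrite mulf_neq0 ?invr_eq0 ?intr_eq0.
have n0 : numq x != 0 by rewrite numq_eq0.
have d0 := denq_neq0 x.
have : numq x * b = a * denq x.
  apply/eqP; rewrite -(eqr_int rat) !intrM -eqr_div ?intr_eq0 //; first by rewrite -xE.
move/(congr1 (fun z => logn p `|z|%N)); rewrite !abszM !lognM ?absz_gt0 //; lia.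
Qed.

Lemma vqM p x y : x != 0 -> y != 0 -> vq p (x * y) = vq p x + vq p y.
Proof.
move=> x0 y0; rewrite -{1}[x]divq_num_den -{1}[y]divq_num_den mulf_div -!intrM.
rewrite vq_frac ?mulf_neq0 ?numq_eq0 ?denq_neq0 // /vq.
by rewrite !abszM !lognM ?absz_gt0 ?numq_eq0 ?denq_neq0 //; lia.
Qed.

Lemma vq_int p (a : int) : vq p a%:~R = logn p `|a|.
Proof. by rewrite /vq numq_int denq_int logn1 subr0. Qed.

Lemma vq_p p : prime p -> vq p p%:R = 1.
Proof. by move=> pp; rewrite -[p%:R]/(p%:Z%:~R) vq_int logn_prime ?eqxx. Qed.

Lemma vq_pX p n : prime p -> vq p (p%:R ^+ n) = n.
Proof.
move=> pp; have p0 : p%:R != 0 :> rat by rewrite pnatr_eq0 -lt0n prime_gt0.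
elim: n => [|n IH]; first by rewrite expr0 -[1]/(1%:~R) vq_int logn1.
by rewrite exprS vqM ?expf_neq0 // vq_p // IH.
Qed.

(* [vq p 0] has the junk value [0], whence the first disjunct. *)
Definition vq_ge (p : nat) (n : int) (x : rat) := (x == 0) || (n <= vq p x).

Lemma vq_ge_le p m n x : m <= n -> vq_ge p n x -> vq_ge p m x.
Proof. by rewrite /vq_ge => mn /orP[->//|h]; rewrite (le_trans mn h) orbT. Qed.

Lemma vq_geM p m n x y : vq_ge p m x -> vq_ge p n y -> vq_ge p (m + n) (x * y).
Proof.
rewrite /vq_ge; case: (eqVneq x 0) => [->|x0] /=; first by rewrite mul0r eqxx.
case: (eqVneq y 0) => [->|y0] /=; first by rewrite mulr0 eqxx.
by move=> h k; rewrite vqM // lerD ?orbT.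
Qed.

Lemma vq_geX p n x k : vq_ge p n x -> vq_ge p (n *+ k) (x ^+ k).
Proof.
move=> h; elim: k => [|k IH]; last by rewrite mulrS exprS vq_geM.
by rewrite /vq_ge expr0 mulr0n -[1]/(1%:~R) vq_int logn1 lexx orbT.
Qed.

Lemma vq_geN p n x : vq_ge p n (- x) = vq_ge p n x.
Proof. by rewrite /vq_ge /vq oppr_eq0 numqN denqN abszN. Qed.

(** The ultrametric inequality: over a common denominator, a power of p dividing two integers
    divides their sum. *)
Lemma vq_geD p n x y : prime p -> vq_ge p n x -> vq_ge p n y -> vq_ge p n (x + y).
Proof.
move=> pp; rewrite /vq_ge; case: (eqVneq x 0) => [->|x0] /=; first by rewrite add0r.
case: (eqVneq y 0) => [->|y0] /=; first by rewrite addr0 (negPf x0).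
case: (eqVneq (x + y) 0) => //= xy0.
set a := numq x * denq y; set b := numq y * denq x; set c := denq x * denq y.
have [dx dy] : denq x != 0 /\ denq y != 0 by rewrite !denq_neq0.
have c0 : c != 0 by rewrite mulf_neq0.
have xE : x = a%:~R / c%:~R.
  by rewrite /a /c !intrM -mulf_div divff ?mulr1 ?divq_num_den // intr_eq0.
have yE : y = b%:~R / c%:~R.
  rewrite /b /c !intrM [X in _ / X]mulrC -mulf_div divff ?mulr1 ?divq_num_den //.
  by rewrite intr_eq0.
have sE : x + y = (a + b)%:~R / c%:~R by rewrite intrD mulrDl -xE -yE.
have a0 : a != 0 by rewrite mulf_neq0 ?numq_eq0.
have b0 : b != 0 by rewrite mulf_neq0 ?numq_eq0.
have s0 : a + b != 0 by apply: contraNneq xy0 => s0; rewrite sE s0 mul0r.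
rewrite sE xE yE !vq_frac // !lerBrDr.
(* A negative threshold [M] makes the bound trivial; otherwise it is divisibility by p^M. *)
set M := n + _; case: (M) => [m|//]; rewrite !lez_nat.
rewrite -!pfactor_dvdn ?absz_gt0 //.
by move=> h k; have : ((p ^ m)%N%:Z %| a + b)%Z by apply: rpredD.
Qed.

Lemma vq_geB p n x y : prime p -> vq_ge p n x -> vq_ge p n y -> vq_ge p n (x - y).
Proof. by move=> pp h k; apply: vq_geD; rewrite ?vq_geN. Qed.

Lemma vq_ge_int p x : x \is a Num.int -> vq_ge p 0 x.
Proof. by move=> /intrP[a ->]; rewrite /vq_ge vq_int orbT. Qed.

Lemma vq_ge1_dvdz p (a : int) : prime p -> vq_ge p 1 a%:~R = (p %| a)%Z.
Proof.
move=> pp; rewrite /vq_ge vq_int intr_eq0; case: eqVneq => [->|a0]; first by rewrite dvdz0.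
by rewrite lez_nat /= dvdzE -[X in (X %| _)%N]/p -(expn1 p) pfactor_dvdn ?absz_gt0.
Qed.

(** Some power of p clears the denominator. While its exponent exceeds n, the resulting integer has
    positive valuation, so one factor p cancels. *)
Lemma Zinv_int p n x : prime p -> Zinv p x -> vq_ge p (- n%:Z) x ->
  x * p%:R ^+ n \is a Num.int.
Proof.
move=> pp [m]; have p0 : p%:R != 0 :> rat by rewrite pnatr_eq0 -lt0n prime_gt0.
case: (leqP m n) => [mn hm _|/ltnW/subnKC <-].
  by rewrite -(subnK mn) exprD mulrCA rpredM ?rpredX ?rpred_nat // mulrC.
move: (m - n)%N => k + h; elim: k => [|k IH]; first by rewrite addn0.
rewrite addnS exprSr mulrA => /intrP[z zE]; apply: IH.
have : vq_ge p 1 z%:~R.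
  have : vq_ge p (n + k + 1)%N%:Z (p%:R ^+ (n + k) * p%:R).
    by rewrite -exprSr /vq_ge vq_pX // addn1 lexx orbT.
  move=> /(vq_geM h); rewrite mulrA zE; apply: vq_ge_le; lia.
rewrite vq_ge1_dvdz // => /dvdzP[w wE]; move: zE; rewrite wE intrM => /(mulIf p0) ->.
exact: intr_int.
Qed.

Lemma Zinv_pv p x : prime p -> Zinv p x -> exists n : nat, vq_ge p (- n%:Z) x.
Proof.
move=> pp [n h]; exists n; case: (eqVneq x 0) => [->|x0]; first by rewrite /vq_ge eqxx.
have p0 : p%:R != 0 :> rat by rewrite pnatr_eq0 -lt0n prime_gt0.
have := vq_ge_int p h; rewrite /vq_ge mulf_eq0 expf_eq0 (negPf x0) (negPf p0) andbF /=.
by rewrite vqM ?expf_neq0 // vq_pX // addrC -lerBlDl sub0r.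
Qed.

(** * Sums of two squares *)

Lemma Fp_int_eq0 p (a : int) : prime p -> (a%:~R == 0 :> 'F_p) = (p %| a)%Z.
Proof.
move=> pp; rewrite dvdzE absz_nat; case: a => n; rewrite ?NegzE ?rmorphN ?oppr_eq0 ?abszN /=;
  by rewrite -(dvdn_pcharf (pchar_Fp pp)).
Qed.

Lemma Fp_expf p (x : 'F_p) : prime p -> x != 0 -> x ^+ p.-1 = 1.
Proof.
move=> pp x0; apply: (mulfI x0); rewrite -exprS prednK ?prime_gt0 // mulr1.
by rewrite -{2}(expf_card x) card_Fp.
Qed.

(* Fermat's little theorem applied to [a] and [b], whose squares are opposite mod [p]. *)
Lemma prime_dvd_sum_sq p (a b : int) : prime p -> odd p ->
  (p %| a ^+ 2 + b ^+ 2)%Z -> ~~ (p %| a)%Z -> (p = 1 %[mod 4])%N.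
Proof.
move=> pp op; rewrite -!Fp_int_eq0 // rmorphD !rmorphXn /=.
set x : 'F_p := a%:~R; set y : 'F_p := b%:~R => /eqP xy x0.
have pE := odd_double_half p; rewrite op /= in pE.
have yE : y ^+ 2 = - x ^+ 2 by apply/eqP; rewrite -addr_eq0 addrC xy.
have y0 : y != 0 by rewrite -sqrf_eq0 yE oppr_eq0 sqrf_eq0.
have p1E : p.-1 = (2 * p./2)%N by lia.
have := Fp_expf pp y0; rewrite p1E exprM yE exprNn -exprM -p1E Fp_expf // mulr1.
(* An odd exponent would give -1 = 1 in ['F_p], so p would divide 2. *)
rewrite -signr_odd; case E : (odd p./2); last by move=> _; lia.
move=> /eqP; rewrite expr1 eq_sym -addr_eq0 -[1 + 1]/(2%:~R) Fp_int_eq0 //.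
by move=> /(dvdn_leq (isT : 0 < 2)%N); have := prime_gt1 pp; lia.
Qed.

(** The polynomial X^((p-1)/2) - 1 has too few roots to vanish at every nonzero element. At a
    nonzero x that is not a root, x^((p-1)/2) = -1 because its square is 1, and x^((p-1)/4) is the
    element sought. *)
Lemma sqrt_opp1_Fp p : prime p -> (p = 1 %[mod 4])%N -> exists r : 'F_p, r ^+ 2 = -1.
Proof.
move=> pp p4; have p1 := prime_gt1 pp.
pose q := (p %/ 4)%N; have pE : p.-1 = (4 * q)%N by rewrite /q; lia.
have q0 : (0 < q)%N by lia.
pose P : {poly 'F_p} := 'X^(2 * q) - 1.
have sP : size P = (2 * q).+1 by rewrite /P size_XnsubC; lia.
have P0 : P != 0 by rewrite -size_poly_eq0 sP.
have [x x0 Px] : exists2 x : 'F_p, x != 0 & ~~ root P x.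
  pose s := rem 0 (enum 'F_p).
  have [/(max_poly_roots P0)/(_ (rem_uniq _ (enum_uniq _)))|/allPn[x]] := boolP (all (root P) s).
    by rewrite sP size_rem ?mem_enum // -cardE card_Fp //; lia.
  by rewrite /s (rem_filter _ (enum_uniq _)) mem_filter /= => /andP[x0 _]; exists x.
exists (x ^+ q); apply/eqP; rewrite -exprM mulnC -addr_eq0.
have : (x ^+ (2 * q) - 1) * (x ^+ (2 * q) + 1) == 0.
  rewrite -subr_sqr -exprM expr1n subr_eq0; apply/eqP.
  by rewrite -(Fp_expf pp x0) pE; congr (_ ^+ _); lia.
rewrite mulf_eq0 => /orP[h|//]; move: Px; rewrite rootE /P !hornerE.
by rewrite h.
Qed.

(* Thue's lemma: [r m + n] takes the same value mod [p] at two distinct points of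
   the square [0 <= m, n <= k], which has more than [p] elements when [k ^ 2 <= p < (k + 1) ^ 2]. *)
Lemma prime_sum_two_squares p : prime p -> (p = 1 %[mod 4])%N ->
  exists a b : int, a ^+ 2 + b ^+ 2 = p%:Z.
Proof.
move=> pp p4; have [r r2] := sqrt_opp1_Fp pp p4.
have [k kp pk] : exists2 k, (k ^ 2 <= p)%N & (p < k.+1 ^ 2)%N.
  elim: (p) => [|n [k h1 h2]]; first by exists 0%N.
  have [h|h] := ltnP n.+1 (k.+1 ^ 2); first by exists k => //; lia.
  by exists k.+1 => //; nia.
pose f (u : 'I_k.+1 * 'I_k.+1) : 'F_p := r * u.1%:R + u.2%:R.
have /injectivePn[u [v uv fuv]] : ~~ injectiveb f.
  apply/injectiveP => /leq_card; rewrite card_prod !card_ord Fp_cast //; lia.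
pose a := (u.1%:Z - v.1%:Z); pose b := (u.2%:Z - v.2%:Z); exists a, b.
have ab0 : 0 < a ^+ 2 + b ^+ 2.
  rewrite lt_neqAle eq_sym addr_ge0 ?sqr_ge0 // andbT paddr_eq0 ?sqr_ge0 // !sqrf_eq0.
  apply: contra uv; rewrite !subr_eq0 !eqz_nat.
  case: u v {fuv a b} => [u1 u2] [v1 v2] /= /andP[/eqP h /eqP h'].
  by apply/eqP; congr pair; apply: val_inj.
have : (p %| a ^+ 2 + b ^+ 2)%Z.
  rewrite -Fp_int_eq0 // rmorphD !rmorphXn /= !rmorphB /=.
  have : r * (u.1%:R - v.1%:R) = - (u.2%:R - v.2%:R).
    move/eqP: fuv; rewrite /f -subr_eq0 => /eqP h.
    by apply/eqP; rewrite -subr_eq0 -h; apply/eqP; ring.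
  move/(congr1 (fun x => x ^+ 2)); rewrite exprMn r2 sqrrN => h.
  by rewrite -[X in _ + X]h mulN1r subrr.
(* A prime is not a square. The strict bound yields a^2 + b^2 <= 2 k^2 < 2p, so this multiple of p
   is p itself. *)
have hk : (k ^ 2 < p)%N.
  rewrite ltn_neqAle kp andbT; rewrite -mulnn; apply/eqP => kE.
  have kd : (k %| p)%N by rewrite -kE dvdn_mulr.
  have := prime_gt1 pp; move/primeP: pp => [_ /(_ _ kd)] /orP[]/eqP; nia.
have bd (m n : 'I_k.+1) : (m%:Z - n%:Z) ^+ 2 <= (k ^ 2)%N.
  have := ltn_ord m; have := ltn_ord n => hn hm.
  have : 0 <= (k%:Z - (m%:Z - n%:Z)) * (k%:Z + (m%:Z - n%:Z)) by rewrite mulr_ge0; lia.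
  by rewrite -subr_sqr subr_ge0 => /le_trans -> //; rewrite -mulnn PoszM expr2.
have := bd u.1 v.1; have := bd u.2 v.2; rewrite -/a -/b => hb ha.
move=> /dvdzP[q qE]; move: ab0 ha hb; rewrite qE => h1 h2 h3.
suff -> : q = 1 by rewrite mul1r.
have : q * p < 2 * p%:Z by rewrite -qE; lia.
have : 0 < p%:Z by rewrite ltz_nat prime_gt0.
nia.
Qed.

Lemma gauss_normE (A : comNzRingType) (I x y : A) : I ^+ 2 = -1 ->
  (x + I * y) * (x - I * y) = x ^+ 2 + y ^+ 2.
Proof. by move=> I2; rewrite mulrC -subr_sqr exprMn I2 mulN1r opprK. Qed.

(* A root of unity [(a + ib)/(a - ib)] would have integral trace
   [2 (a^2 - b^2) / p], although [p] divides neither [2] nor [a^2 - b^2]. *)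
Lemma rotation_not_unity p (a b : int) (n : nat) : prime p -> odd p ->
  a ^+ 2 + b ^+ 2 = p%:Z -> (0 < n)%N ->
  (((a%:~R + 'i * b%:~R) ^+ 2 / p%:R) ^+ n != 1 :> algC).
Proof.
move=> pp op E n0; apply/eqP; set w : algC := _ / _ => wn.
have p0 : p%:R != 0 :> algC by rewrite pnatr_eq0 -lt0n prime_gt0.
(* Since p = (a + ib)(a - ib), [w] is (a + ib)/(a - ib) and [w'] is its inverse. Both are roots of
   unity, so their sum, which is rational, is an algebraic integer. *)
pose w' : algC := (a%:~R - 'i * b%:~R) ^+ 2 / p%:R.
have pE : p%:R = a%:~R ^+ 2 + b%:~R ^+ 2 :> algC.
  by rewrite -[p%:R]/(p%:Z%:~R) -E rmorphD !rmorphXn.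
have ii : 'i ^+ 2 = -1 :> algC := sqrCi _.
have ww' : w * w' = 1.
  have conj : (a%:~R + 'i * b%:~R) * (a%:~R - 'i * b%:~R) = p%:R :> algC.
    by rewrite gauss_normE ?sqrCi // -pE.
  rewrite /w /w' mulf_div -exprMn conj.
  by rewrite expr2 divff // mulf_neq0.
have wA : w \in Aint by apply: (@Aint_unity_root n) => //; apply/unity_rootP.
have w'A : w' \in Aint.
  apply: (@Aint_unity_root n) => //; apply/unity_rootP.
  by rewrite -[LHS]mul1r -{1}wn -exprMn ww' expr1n.
pose c : rat := (2 * (a ^+ 2 - b ^+ 2))%:~R / p%:R.
have cE : w + w' = ratr c.
  rewrite /c fmorph_div /= ratr_int ratr_nat /w /w' -mulrDl; congr (_ / _).
  rewrite !rmorphM rmorphB !rmorphXn /= -[2%:~R]/(2%:R : algC).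
  by rewrite sqrrB sqrrD exprMn ii; ring.
have : c \is a Num.int.
  rewrite -Cint_rat -cE Cint_rat_Aint //; last exact: rpredD.
  by rewrite cE; apply/CratP; exists c.
move=> /intrP[m]; rewrite /c => /(canRL (divfK _)) h.
have {}h : 2 * (a ^+ 2 - b ^+ 2) = m * p.
  by apply/eqP; rewrite -(eqr_int rat) h ?pnatr_eq0 -?lt0n ?prime_gt0 // intrM.
(* Adds 2 (a^2 + b^2) = 2p to 2 (a^2 - b^2) = mp. *)
have h4 : (p %| 4 * a ^+ 2)%Z.
  by apply/dvdzP; exists (m + 2); rewrite [RHS]mulrDl -h -E; ring.
have pa : (p %| a)%Z.
  move: h4; rewrite -!Fp_int_eq0 // expr2 !intrM !mulf_eq0 orbb !Fp_int_eq0 //.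
  case/orP=> //; rewrite dvdzE (Euclid_dvdM 2 2 pp) orbb => /(dvdn_leq (isT : 0 < 2)%N).
  by have := prime_gt1 pp; lia.
have p1 := prime_gt1 pp.
(* A nonzero multiple of p has square at least p^2 >= 2p, more than a^2 + b^2 = p. With a = 0, the
   prime p would be the square b^2. *)
have a0 : a = 0.
  apply/eqP; apply: contraT => a0.
  have : (p <= `|a|)%N by apply: dvdn_leq; rewrite ?absz_gt0.
  move=> ha; have aa : a ^+ 2 = `|a|%N%:Z ^+ 2 by rewrite abszE real_normK ?num_real.
  have pp2 : p%:Z ^+ 2 <= a ^+ 2 by rewrite aa lerXn2r ?nnegrE.
  have p2p : 2 * p%:Z <= p%:Z ^+ 2 by rewrite expr2 ler_wpM2r.
  have p0' : 0 < p%:Z by rewrite ltz_nat prime_gt0.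
  have b2 := sqr_ge0 b; clear -E pp2 p2p p0' b2; lra.
move: E; rewrite a0 expr0n add0r => bE.
have pE2 : p = (`|b| * `|b|)%N.
  by apply/eqP; rewrite -eqz_nat -bE PoszM abszE -expr2 real_normK ?num_real.
have b1 : `|b|%N != 1%N by apply: contraL p1 => /eqP b1; rewrite pE2 b1.
have bp : (`|b| %| p)%N by rewrite pE2 dvdn_mulr.
move/primeP: pp => [_ /(_ _ bp)]; rewrite (negPf b1) /= => /eqP bE'.
by move: pE2 p1; rewrite bE'; clear; nia.
Qed.

(** * The real surface and its compact part *)

Lemma big_ord3_neq (A : Type) (idx : A) (op : Monoid.com_law idx)
    (F : 'I_3 -> A) i j k :
  i != j -> j != k -> i != k -> \big[op/idx]_(l | l != i) F l = op (F j) (F k).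
Proof.
move=> ij jk ik; have ji : j != i by rewrite eq_sym.
have kij : (k != i) && (k != j) by rewrite !(eq_sym k) ik jk.
rewrite (bigD1 j) // (bigD1 k) //= big_pred0 ?Monoid.mulm1 // => l.
apply: contraNF ik => /andP[/andP[li lj] lk]; move: i j k l ij jk li lj lk {ji kij}.
by do 4! case=> [[|[|[|//]]] ?].
Qed.

Lemma big_ord3_distinct (A : Type) (idx : A) (op : Monoid.com_law idx)
    (F : 'I_3 -> A) i j k :
  i != j -> j != k -> i != k -> \big[op/idx]_l F l = op (F i) (op (F j) (F k)).
Proof. by move=> ij jk ik; rewrite (bigD1 i) // (big_ord3_neq _ _ ij jk ik). Qed.

(** The labelling i, j, k is arbitrary, so that later arguments can single out any coordinate. *)
Lemma surfaceE (A : comNzRingType) (D : A) (X : 'rV[A]_3) i j k :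
  i != j -> j != k -> i != k ->
  surface D X <-> X 0 i ^+ 2 + X 0 j ^+ 2 + X 0 k ^+ 2
                  + X 0 i * X 0 j * X 0 k = D.
Proof.
by move=> ij jk ik; rewrite /surface /= !(big_ord3_distinct _ _ ij jk ik) /= !addrA mulrA.
Qed.

Lemma ord3_compl (i : 'I_3) : exists j k : 'I_3, [/\ i != j, j != k & i != k].
Proof.
case: i => [[|[|[|//]]] ?]; do [
  by exists (inord 0), (inord 1); rewrite -!val_eqE /= !inordK
| by exists (inord 0), (inord 2); rewrite -!val_eqE /= !inordK
| by exists (inord 1), (inord 2); rewrite -!val_eqE /= !inordK].
Qed.

Lemma ord3_cases (i j k l : 'I_3) : i != j -> j != k -> i != k ->
  [\/ l = i, l = j | l = k].
Proof.
move=> ij jk ik; case: (eqVneq l i) => [|li]; first by constructor 1.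
case: (eqVneq l j) => [|lj]; first by constructor 2.
constructor 3; apply: val_inj; move: i j k l ij jk ik li lj.
by do 4! case=> [[|[|[|//]]] ?].
Qed.

Lemma row_continuous (R : realType) n (f : R -> 'rV[R]_n) :
  (forall i, continuous (fun s => f s 0 i)) -> continuous f.
Proof.
move=> cf s N [P HP sP].
have H i : \forall t \near s, forall j, P i j (f t i j).
  apply: (@filter_forall _ _ (fun j t => P i j (f t i j)) _ (nbhs_filter s)) => j.
  by move: (HP i j); rewrite ord1 => h; exact: cf.
apply: filterS (@filter_forall _ _ _ _ (nbhs_filter s) H) => t; exact: sP.
Qed.

(* If [2 <= `|X i|] then, with [X i] fixed, the surface cuts a hyperbola; scaling
   the coordinate [X j] by [s >= 1] runs to infinity along its branch through X. *)
Lemma compact_part_lt2 (R : realType) (D : R) (X : 'rV[R]_3) i :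
  D < 4 -> compact_part D X -> `|X 0 i| < 2.
Proof.
move=> D4 [SX cX]; case: (ltP `|X 0 i| 2) => // ge2; exfalso.
have [j [k [ij jk ik]]] := ord3_compl i.
set c := X 0 i in ge2; set x := X 0 j; set y := X 0 k.
have E : c ^+ 2 + x ^+ 2 + y ^+ 2 + c * x * y = D by apply/(surfaceE _ _ ij jk ik).
have c4 : 4 <= c ^+ 2 by rewrite -(real_normK (num_real c)); nra.
have x0 : x != 0.
  by apply: contraTneq D4 => x0; rewrite -leNgt -E x0; nra.
(* The discriminant of the surface equation as a quadratic in the k-th coordinate, the other two
   being c and s x. The sign [e] selects the root for which [f 1 = X]. *)
pose disc (s : R) := (s * x) ^+ 2 * (c ^+ 2 - 4) - 4 * (c ^+ 2 - D).
pose e : R := if 0 <= 2 * y + c * x then 1 else -1.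
pose z (s : R) := (- (c * (s * x)) + e * Num.sqrt (disc s)) / 2.
pose f (s : R) : 'rV[R]_3 :=
  \row_l (if l == i then c else if l == j then s * x else z s).
have disc1 : disc 1 = (2 * y + c * x) ^+ 2 by rewrite /disc -E; ring.
have f1 : f 1 = X.
  apply/rowP => l; rewrite mxE; have ji : j == i = false by rewrite eq_sym (negPf ij).
  have [->|->|->] := ord3_cases l ij jk ik; rewrite ?eqxx ?ji ?mul1r //.
  rewrite (eq_sym k i) (eq_sym k j) (negPf ik) (negPf jk) /z disc1 sqrtr_sqr /e mul1r.
  by case: (leP 0 (2 * y + c * x)) => h;
    rewrite ?(ger0_norm h) ?(ltr0_norm h) -/y; field.
have fS s : 1 <= s -> surface D (f s).
  move=> s1; apply/(surfaceE _ _ ij jk ik); rewrite !mxE !eqxx.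
  rewrite (eq_sym j i) (eq_sym k i) (eq_sym k j) (negPf ij) (negPf ik) (negPf jk).
  (* At s = 1 the discriminant is a square, and it does not decrease for s >= 1 because c^2 >= 4. *)
  have d0 : 0 <= disc s.
    apply: le_trans (_ : disc 1 <= _); first by rewrite disc1 sqr_ge0.
    by rewrite /disc mul1r lerD2r ler_wpM2r ?subr_ge0 // exprMn ler_peMl ?sqr_ge0 ?exprn_ege1.
  have e2 : (e * Num.sqrt (disc s)) ^+ 2 = disc s.
    by rewrite exprMn sqr_sqrtr // /e; case: ifP => _; rewrite ?sqrrN expr1n mul1r.
  have -> : D = c ^+ 2 + (s * x) ^+ 2 + (disc s - (c * (s * x)) ^+ 2) / 4.
    by rewrite /disc; field.
  by rewrite -e2 /z; field.
have cf : continuous f.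
  apply: row_continuous => l.
  have sc : continuous (fun s : R => s * x).
    by move=> s; apply: cvgM; [exact: cvg_id|exact: cvg_cst].
  have [->|->|->] := ord3_cases l ij jk ik; under eq_fun do
    rewrite mxE ?eqxx ?(eq_sym j i) ?(eq_sym k i) ?(eq_sym k j) ?(negPf ij) ?(negPf ik) ?(negPf jk).
  - by move=> s; apply: cvg_cst.
  - exact: sc.
  move=> s; apply: cvgM; last exact: cvg_cst.
  apply: cvgD.
    by apply: cvgN; apply: cvgM; [exact: cvg_cst|exact: sc].
  apply: cvgM; first exact: cvg_cst.
  apply: (@continuous_comp _ _ _ disc Num.sqrt); last exact: sqrt_continuous.
  apply: cvgB; last exact: cvg_cst.
  apply: cvgM; last exact: cvg_cst.
  rewrite /=; under eq_fun do rewrite expr2.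
  by rewrite expr2; apply: cvgM; exact: sc.
have sub : f @` `[1, +oo[ `<=` connected_component (surface D) X.
  apply: connected_component_max.
  - by exists 1 => //=; rewrite in_itv /= lexx.
  - by move=> _ [s /= s1 <-]; apply: fS; move: s1; rewrite in_itv /= andbT.
  apply: connected_continuous_connected; last exact: continuous_subspaceT.
  exact/connected_intervalP/interval_is_interval.
have cj : compact ((fun M : 'rV[R]_3 => M 0 j) @` connected_component (surface D) X).
  by apply: continuous_compact cX; apply: continuous_subspaceT; exact: coord_continuous.
have [M0 [_ HM0]] := compact_bounded (cj : compact (_ : set R^o)).
pose M := `|M0| + 1.
have HM u : connected_component (surface D) X u -> `|u 0 j| <= M.
  move=> Xu; apply: (HM0 M); last by exists u.
  by rewrite /M; have := ler_norm M0; lra.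
(* Chosen so that |s x| = |x| + |M| > M. *)
pose s := 1 + `|M| / `|x|.
have nx : 0 < `|x| by rewrite normr_gt0.
have s1 : 1 <= s by rewrite lerDl divr_ge0.
have : `|s * x| <= M.
  have := HM (f s); rewrite mxE eqxx (eq_sym j i) (negPf ij); apply; apply: sub.
  by exists s => //=; rewrite in_itv /= s1.
rewrite normrM (ger0_norm (le_trans _ s1)) // mulrDl mul1r divfK ?gt_eqF //.
by have := ler_norm M; lra.
Qed.

(** Completing the square: D - x^2 = (y + xz/2)^2 + z^2 (1 - x^2/4). The field is a general one
    because the descent takes place over the rationals. *)
Lemma surface_sq_le (R : realFieldType) (D : R) (X : 'rV[R]_3) :
  surface D X -> (forall i, `|X 0 i| < 2) -> forall i, X 0 i ^+ 2 <= D.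
Proof.
move=> SX b i; have [j [k [ij jk ik]]] := ord3_compl i.
have <- := (surfaceE D X ij jk ik).1 SX.
have x4 : X 0 i ^+ 2 <= 2 ^+ 2.
  by rewrite -(real_normK (num_real _)) lerXn2r ?nnegrE // ltW.
move: x4; move: (X 0 i) (X 0 j) (X 0 k) => x y z x4.
have h1 := sqr_ge0 (y + x * z / 2).
have h2 : 0 <= z ^+ 2 * (1 - x ^+ 2 / 4) by rewrite mulr_ge0 ?sqr_ge0 //; lra.
have -> : x ^+ 2 + y ^+ 2 + z ^+ 2 + x * y * z =
  x ^+ 2 + ((y + x * z / 2) ^+ 2 + z ^+ 2 * (1 - x ^+ 2 / 4)) by field.
by rewrite lerDl addr_ge0.
Qed.

(** * Vieta involutions *)

Lemma vieta_neq (A : comNzRingType) (X : 'rV[A]_3) i j :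
  j != i -> vieta i X 0 j = X 0 j.
Proof. by move=> /negPf ji; rewrite mxE ji. Qed.

Lemma vieta_eq (A : comNzRingType) (X : 'rV[A]_3) i j k :
  i != j -> j != k -> i != k -> vieta i X 0 i = - X 0 i - X 0 j * X 0 k.
Proof. by move=> ij jk ik; rewrite mxE eqxx (big_ord3_neq _ _ ij jk ik). Qed.

Lemma vietaK (A : comNzRingType) i : involutive (@vieta A i).
Proof.
move=> X; apply/rowP => l; have [j [k [ij jk ik]]] := ord3_compl i.
have [->|li] := eqVneq l i; last by rewrite !vieta_neq.
rewrite (vieta_eq _ ij jk ik) (vieta_eq X ij jk ik) !vieta_neq 1?eq_sym //.
by ring.
Qed.

Lemma vieta_surface (A : comNzRingType) (D : A) i (X : 'rV[A]_3) :
  surface D X -> surface D (vieta i X).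
Proof.
have [j [k [ij jk ik]]] := ord3_compl i => SX; apply/(surfaceE _ _ ij jk ik).
have <- := (surfaceE D X ij jk ik).1 SX.
rewrite (vieta_eq _ ij jk ik) !vieta_neq 1?eq_sym //.
by ring.
Qed.

Lemma vieta_orbit (A : comNzRingType) i (Y X : 'rV[A]_3) :
  Gamma_orbit Y (vieta i X) -> Gamma_orbit Y X.
Proof.
move=> [g Gg E]; exists (vieta i \o g); first exact: Gamma_comp (Gamma_vieta _ i) Gg.
by rewrite /= -E vietaK.
Qed.

(** * Descent *)

Lemma ZinvB p x y : Zinv p x -> Zinv p y -> Zinv p (x - y).
Proof.
move=> [m xm] [n yn]; exists (m + n)%N; rewrite exprD.
have -> : (x - y) * (p%:R ^+ m * p%:R ^+ n) =
  x * p%:R ^+ m * p%:R ^+ n - y * p%:R ^+ n * p%:R ^+ m by ring.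
by rewrite rpredB // rpredM ?rpredX ?rpred_nat.
Qed.

Lemma ZinvM p x y : Zinv p x -> Zinv p y -> Zinv p (x * y).
Proof. by move=> [m xm] [n yn]; exists (m + n)%N; rewrite exprD mulrACA rpredM. Qed.

Lemma Zinv_intr p (a : int) : Zinv p a%:~R.
Proof. by exists 0%N; rewrite mulr1 intr_int. Qed.

Lemma Zinv_invp p : prime p -> Zinv p p%:R^-1.
Proof. by move=> pp; exists 1%N; rewrite mulVf ?pnatr_eq0 -?lt0n ?prime_gt0. Qed.

Lemma surface_Zinv_vieta p D i X :
  surface_Zinv p D X -> surface_Zinv p D (vieta i X).
Proof.
move=> [SX ZX]; split; first exact: vieta_surface.
move=> l; have [->|li] := eqVneq l i; last by rewrite vieta_neq.
have [j [k [ij jk ik]]] := ord3_compl i; rewrite (vieta_eq _ ij jk ik).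
apply: ZinvB; last exact: ZinvM.
by rewrite -sub0r; apply: ZinvB => //; exact: (Zinv_intr p 0).
Qed.

Lemma valp_double_lt p x D : D != 0 ->
  (2%R%:E * valp p x < valp p D)%E = (x != 0) && (2 * vq p x < vq p D).
Proof.
move=> D0; rewrite /valp (negPf D0); case: eqVneq => [_|x0] /=.
  by rewrite gt0_muley ?lte_fin // ltNge leey.
by rewrite -EFinM lte_fin.
Qed.

Lemma int_norm_lt1 (x : rat) : x \is a Num.int -> `|x| < 1 -> x = 0.
Proof.
by move=> /intrP[z ->]; rewrite -intr_norm -[1]/(1%:~R) ltr_int => h; suff -> : z = 0 by []; lia.
Qed.

Lemma vq_ge_tight p (n : nat) x : vq_ge p (- n.+1%:Z) x -> ~ vq_ge p (- n%:Z) x ->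
  x != 0 /\ vq p x = - n.+1%:Z.
Proof. by rewrite /vq_ge; case: eqVneq => //= _ h1 h2; split=> //; lia. Qed.

Lemma vq_ge_sqr p b x : vq_ge p (- b) x -> vq_ge p (- (2 * b)) (x ^+ 2).
Proof. by move=> /(@vq_geX _ _ _ 2); apply: vq_ge_le; rewrite mulr2n; lia. Qed.

(** The points where the descent stops. The guard [X 0 i != 0] accounts for val_p(0) being infinite,
    whereas [vq p 0] is 0. *)
Definition vq_large p D : set 'rV[rat]_3 :=
  [set X | surface_Zinv p D X /\
    forall i, X 0 i != 0 -> vq p D <= 2 * vq p (X 0 i)].

(** Induction on n, where p^n bounds the denominators. A Vieta move is made only when a single
    coordinate has valuation -(n+1). *)
Lemma descent p D n X : prime p -> 0 < D -> D < 1 ->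
  surface_Zinv p D X -> (forall i, `|X 0 i| < 2) ->
  (forall i, vq_ge p (- n%:Z) (X 0 i)) ->
  exists2 Y, Gamma_orbit Y X &
    (vq_large p D Y /\ (forall i, `|Y 0 i| < 1)) \/ exceptional_set p D Y.
Proof.
move=> pp D0 D1; elim: n X => [|n IH] X ZX bX vX.
all: have [SX ZX'] := ZX.
all: have b1 i : `|X 0 i| < 1 by
  rewrite -(@ltr_pXn2r _ 2) ?nnegrE // expr1n real_normK ?num_real // (le_lt_trans _ D1) //;
  exact: surface_sq_le.
all: have X_int i : vq_ge p 0 (X 0 i) -> X 0 i = 0 by
  move=> v; apply: int_norm_lt1 (b1 i);
  have := @Zinv_int p 0 _ pp (ZX' i); rewrite oppr0 mulr1; exact.
  (* In the base case every coordinate vanishes, so D would be 0. *)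
  have X0 i : X 0 i = 0 by apply: X_int; have := vX i; rewrite oppr0.
  move: D0; rewrite -((surfaceE D X (i := 0) (j := 1) (k := 2%:R) isT isT isT).1 SX).
  by rewrite !X0 !expr0n /= !mulr0 !addr0 ltxx.
have [v'X|] := pselect (forall i, vq_ge p (- n%:Z) (X 0 i)); first exact: IH.
move=> /existsNP[i nvi]; set a := n.+1%:Z.
have [xi0 vi] := vq_ge_tight (vX i) nvi; rewrite -/a in vi.
have [Dv|Dv] := leP (vq p D) (2 * - a).
  exists X; first by exists id => //; exact: Gamma_id.
  left; split=> //; split=> // j xj0; apply: le_trans Dv _.
  by move: (vX j); rewrite /vq_ge (negPf xj0) /= -/a; clear; lia.
have vq_geD' : vq_ge p (1 - 2 * a) D by rewrite /vq_ge; apply/orP; right; clear -Dv; lia.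
have [j [k [ij jk ik]]] := ord3_compl i.
have E := (surfaceE D X ij jk ik).1 SX.
(* The squares and D have valuation at least -2a, and X_i X_l has exactly -2a, so X_m is p-integral
   and hence zero. *)
have tie l m : i != l -> l != m -> i != m -> ~ vq_ge p (- n%:Z) (X 0 l) ->
    exceptional_set p D X.
  move=> il lm im nvl; have El := (surfaceE D X il lm im).1 SX.
  have [xl0 vl] := vq_ge_tight (vX l) nvl; rewrite -/a in vl.
  have xm0 : X 0 m = 0.
    apply: X_int; rewrite /vq_ge; case: eqVneq => //= xm0.
    have : vq_ge p (- (2 * a)) (X 0 i * X 0 l * X 0 m).
      have -> : X 0 i * X 0 l * X 0 m = D - X 0 i ^+ 2 - X 0 l ^+ 2 - X 0 m ^+ 2.
        by rewrite -El; ring.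
      do 3 (apply: vq_geB => //; last by apply: vq_ge_sqr; exact: vX).
      by apply: vq_ge_le vq_geD'; clear; lia.
    rewrite /vq_ge !mulf_eq0 (negPf xi0) (negPf xl0) (negPf xm0) /=.
    by rewrite !vqM ?mulf_neq0 // vi vl; clear; lia.
  split=> //; first by rewrite (big_ord3_distinct _ _ il lm im) /= xm0 !mulr0.
  by exists i; rewrite valp_double_lt ?(gt_eqF D0) // xi0 vi.
have self : exceptional_set p D X -> exists2 Y, Gamma_orbit Y X &
    (vq_large p D Y /\ (forall i, `|Y 0 i| < 1)) \/ exceptional_set p D Y.
  by move=> eX; exists X; [exists id => //; exact: Gamma_id | right].
have [vj|/negP nvj] := boolP (vq_ge p (- n%:Z) (X 0 j)); last first.
  by apply: self; apply: (tie j k).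
have [vk|/negP nvk] := boolP (vq_ge p (- n%:Z) (X 0 k)); last first.
  by apply: self; apply: (tie k j); rewrite // eq_sym.
have jk_neq : (j == i = false) * (k == i = false).
  by rewrite !(eq_sym _ i) (negPf ij) (negPf ik).
have [||Y XY FY] := IH (vieta i X) (surface_Zinv_vieta i ZX).
(* The new coordinate is at most |X_i| + |X_j X_k| < 2, which is all that the induction hypothesis
   asks. *)
- move=> l; have [->|li] := eqVneq l i; last by rewrite vieta_neq.
  rewrite (vieta_eq _ ij jk ik) (le_lt_trans (ler_normB _ _)) // normrN normrM.
  have h1 := b1 i; have h2 : `|X 0 j| * `|X 0 k| <= 1.
    by apply: mulr_ile1; rewrite ?normr_ge0 ?(ltW (b1 _)).
  by clear -h1 h2; lra.
- move=> l; have [->|->|->] := ord3_cases l ij jk ik; last 2 first.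
  + by rewrite vieta_neq ?jk_neq.
  + by rewrite vieta_neq ?jk_neq.
  have [->|x'0] := eqVneq (vieta i X 0 i) 0; first by rewrite /vq_ge eqxx.
  (* As X_i has valuation -a, the new coordinate gets at least 1 - a = -n. *)
  have : vq_ge p (1 - 2 * a) (X 0 i * vieta i X 0 i).
    have -> : X 0 i * vieta i X 0 i = X 0 j ^+ 2 + X 0 k ^+ 2 - D.
      by rewrite (vieta_eq _ ij jk ik) -E; ring.
    apply: vq_geB => //; apply: vq_geD => //.
      by apply: vq_ge_le (vq_ge_sqr vj); rewrite /a; clear; lia.
    by apply: vq_ge_le (vq_ge_sqr vk); rewrite /a; clear; lia.
  by rewrite /vq_ge mulf_eq0 (negPf xi0) (negPf x'0) /= vqM // vi /a; clear; lia.
- by exists Y => //; exact: vieta_orbit XY.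
Qed.

(** * Finiteness of the stopping points *)

Lemma finite_bounded_denom p m : prime p ->
  finite_set [set X : 'rV[rat]_3 |
    forall i, X 0 i * p%:R ^+ m \is a Num.int /\ `|X 0 i| < 1].
Proof.
move=> pp; have M0 : (0 < p ^ m)%N by rewrite expn_gt0 prime_gt0.
(* Numerators over p^m lie between -M and M; shifted by M they become ordinals below 2M + 1. *)
pose M := (p ^ m)%N; pose g (f : {ffun 'I_3 -> 'I_(2 * M).+1}) : 'rV[rat]_3 :=
  \row_i (((f i)%:Z - M%:Z)%:~R / M%:R).
apply: sub_finite_set (finite_image g (@finite_finset _ setT)) => X hX.
have M0' : 0 < M%:R :> rat by rewrite ltr0n.
have /choice[z zE] : forall i, exists z : int, X 0 i * M%:R = z%:~R.
  by move=> i; apply/intrP; rewrite natrX; exact: (hX i).1.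
have zM i : `|z i| < M%:Z.
  rewrite -(ltr_int rat) intr_norm -zE normrM (ger0_norm (ltW M0')).
  by rewrite -[ltRHS]mul1r ltr_pM2r // (hX i).2.
exists [ffun i => inord `|(z i + M%:Z)%R|%N] => //; apply/rowP => i; rewrite !mxE ffunE.
rewrite inordK; last by have := zM i; lia.
have -> : (`|(z i + M%:Z)%R|%N)%:Z - M%:Z = z i by have := zM i; lia.
by rewrite -zE mulfK // gt_eqF.
Qed.

(** From 2 val_p(X_i) >= val_p(D) follows val_p(X_i) >= -|val_p(D)|, a crude but uniform bound on
    denominators. *)
Lemma finite_vq_large p D : prime p ->
  finite_set (vq_large p D `&` [set X | forall i, `|X 0 i| < 1]).
Proof.
move=> pp; apply: sub_finite_set (@finite_bounded_denom p `|vq p D|%N pp) => X [[[_ ZX] vX] bX] i.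
split=> //; apply: Zinv_int => //; rewrite /vq_ge; case: eqVneq => //= x0.
by have := vX i x0; lia.
Qed.

(** * Exceptional points *)

(** With t = y/x, D = x^2 (1 + t^2), so 1 + t^2 has positive valuation and p divides the sum of the
    squares of the coprime numerator and denominator of t. *)
Lemma vq_sum_sq_mod4 p (x y D : rat) : prime p -> odd p -> D != 0 ->
  x ^+ 2 + y ^+ 2 = D -> x != 0 -> 2 * vq p x < vq p D -> (p = 1 %[mod 4])%N.
Proof.
move=> pp op D0 E x0 vx; set t := y / x.
have DE : D = x ^+ 2 * (1 + t ^+ 2).
  by rewrite -E /t mulrDr mulr1 -exprMn mulrCA divff // mulr1.
have t0 : 1 + t ^+ 2 != 0 by apply: contraNneq D0 => t0; rewrite DE t0 mulr0.
have vt : vq_ge p 1 (1 + t ^+ 2).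
  by move: vx; rewrite DE vqM ?expf_neq0 // expr2 vqM // /vq_ge (negPf t0) /=; lia.
have pd : (p %| denq t ^+ 2 + numq t ^+ 2)%Z.
  have : vq_ge p (0 + 1) ((denq t)%:~R ^+ 2 * (1 + t ^+ 2)).
    by apply: vq_geM vt; apply: vq_ge_int; rewrite rpredX ?intr_int.
  rewrite add0r mulrDr mulr1 -exprMn [_ * t]mulrC -numqE -!rmorphXn -rmorphD /=.
  by rewrite vq_ge1_dvdz.
apply: (prime_dvd_sum_sq pp op pd); apply/negP => pdt.
have pnt : (p %| numq t)%Z.
  move: pd; rewrite -!Fp_int_eq0 // rmorphD !rmorphXn /= in pdt *.
  by rewrite (eqP pdt) expr0n add0r expf_eq0.
have := coprime_num_den t; rewrite /coprime => /eqP g1.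
have : (p %| 1)%N by rewrite -g1 dvdn_gcd; move: pnt pdt; rewrite !dvdzE => -> ->.
by rewrite dvdn1 => /eqP p1; move: pp; rewrite p1.
Qed.

Lemma exceptional_mod4 p D X : prime p -> odd p -> 0 < D -> exceptional_set p D X ->
  (p = 1 %[mod 4])%N /\ exists x0 y0 : rat,
    [/\ Zinv p x0, Zinv p y0 & x0 ^+ 2 + y0 ^+ 2 = D].
Proof.
move=> pp op D0 [[SX ZX] /eqP/prodf_eq0[k _ /eqP xk0] [i]].
rewrite valp_double_lt ?(gt_eqF D0) // => /andP[xi0 vi].
have [j [l [kj jl kl]]] := ord3_compl k.
have := (surfaceE D X kj jl kl).1 SX; rewrite xk0 expr0n add0r !mul0r addr0 => E.
split; last by exists (X 0 j), (X 0 l).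
have [ik|ij|il] := ord3_cases i kj jl kl.
- by rewrite ik xk0 eqxx in xi0.
- by apply: (vq_sum_sq_mod4 pp op (lt0r_neq0 D0) E); rewrite -ij.
- by rewrite addrC in E; apply: (vq_sum_sq_mod4 pp op (lt0r_neq0 D0) E); rewrite -il.
Qed.

(** * Infinitely many exceptional points by rotation *)

(** Multiplication of u.1 + i u.2 by (a + ib)^2 / p, in real and imaginary parts. *)
Definition gauss_rot (a b p : rat) (u : rat * rat) : rat * rat :=
  ((u.1 * (a ^+ 2 - b ^+ 2) - u.2 * (2 * a * b)) / p,
   (u.1 * (2 * a * b) + u.2 * (a ^+ 2 - b ^+ 2)) / p).

Lemma gauss_mulE (A : comNzRingType) (I x y a b : A) : I ^+ 2 = -1 ->
  x * (a ^+ 2 - b ^+ 2) - y * (2 * a * b) +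
    I * (x * (2 * a * b) + y * (a ^+ 2 - b ^+ 2)) = (x + I * y) * (a + I * b) ^+ 2.
Proof.
move=> I2; transitivity (x * a ^+ 2 + 2 * I * x * a * b + I * y * a ^+ 2 +
  I ^+ 2 * (x * b ^+ 2 + 2 * y * a * b + I * y * b ^+ 2)); last by ring.
by rewrite I2; ring.
Qed.

(** The rotated points are pairwise distinct, and each is exceptional or a stopping point. There are
    finitely many stopping points, so a finite exceptional set would make the natural numbers
    finite. *)
Lemma exceptional_infinite p D : prime p -> odd p -> 0 < D -> D < 1 ->
  (p = 1 %[mod 4])%N ->
  (exists x0 y0 : rat, [/\ Zinv p x0, Zinv p y0 & x0 ^+ 2 + y0 ^+ 2 = D]) ->
  infinite_set (exceptional_set p D).
Proof.
move=> pp op D0 D1 p4 [x0 [y0 [Zx0 Zy0 E0]]] exc_fin.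
have [a [b ab]] := prime_sum_two_squares pp p4.
have p0 : p%:R != 0 :> rat by rewrite pnatr_eq0 -lt0n prime_gt0.
have abq : a%:~R ^+ 2 + b%:~R ^+ 2 = p%:R :> rat.
  by rewrite -[p%:R]/(p%:Z%:~R) -ab rmorphD !rmorphXn.
pose rot := gauss_rot a%:~R b%:~R p%:R.
pose u n := iter n rot (x0, y0).
pose w : algC := (a%:~R + 'i * b%:~R) ^+ 2 / p%:R.
pose emb (v : rat * rat) : algC := ratr v.1 + 'i * ratr v.2.
have emb_rot v : emb (rot v) = emb v * w.
  rewrite /emb /rot /gauss_rot /w /= !(fmorph_div, rmorphB, rmorphD, rmorphM, rmorphXn) /=.
  rewrite !ratr_nat !ratr_int [X in _ + X]mulrA -mulrDl [RHS]mulrA; congr (_ / _).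
  by rewrite !rmorph1 -!expr2; apply: gauss_mulE; exact: sqrCi.
have uw n : emb (u n) = emb (x0, y0) * w ^+ n.
  by elim: n => [|n IH]; rewrite ?mulr1 // /u iterS emb_rot IH exprSr mulrA.
have uP n : [/\ Zinv p (u n).1, Zinv p (u n).2 & (u n).1 ^+ 2 + (u n).2 ^+ 2 = D].
  elim: n => [//|n]; rewrite /u iterS -/(u n); case: (u n) => v1 v2 /= [Z1 Z2 vD].
  have ZD x y : Zinv p x -> Zinv p y -> Zinv p (x + y).
    move=> hx hy; rewrite -[y]opprK; apply: ZinvB => //; rewrite -sub0r.
    by apply: ZinvB => //; exact: (Zinv_intr p 0).
  have Zc : Zinv p (a%:~R ^+ 2 - b%:~R ^+ 2) by rewrite -!rmorphXn -rmorphB; exact: Zinv_intr.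
  have Zd : Zinv p (2 * a%:~R * b%:~R).
    by rewrite -[2]/(2%:~R) -!rmorphM; exact: Zinv_intr.
  split.
  - by apply: ZinvM (Zinv_invp pp); apply: ZinvB; exact: ZinvM.
  - by apply: ZinvM (Zinv_invp pp); apply: ZD; exact: ZinvM.
  - transitivity ((v1 ^+ 2 + v2 ^+ 2) * (a%:~R ^+ 2 + b%:~R ^+ 2) ^+ 2 / p%:R ^+ 2).
      by field.
    by rewrite vD abq mulfK // expf_neq0.
(* The product with the conjugate is D, which is nonzero; this allows cancellation in the proof of
   injectivity. *)
have u_neq0 n : emb (u n) != 0.
  apply: contraTneq D0 => e0; suff -> : D = 0 by rewrite ltxx.
  have [_ _ <-] := uP n; apply/eqP.
  rewrite -(fmorph_eq0 (ratr : rat -> algC)) rmorphD !rmorphXn /=.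
  apply/eqP; transitivity (emb (u n) * (ratr (u n).1 - 'i * ratr (u n).2)).
    by rewrite gauss_normE ?sqrCi.
  by rewrite e0 mul0r.
have u_inj : injective u.
  suff lt_neq m n : (m < n)%N -> u m <> u n.
    move=> m n umn; case: (ltngtP m n) => // h; first by case: (lt_neq _ _ h).
    by case: (lt_neq _ _ h).
  move=> mn umn; have := rotation_not_unity pp op ab (n := n - m); rewrite subn_gt0 => /(_ mn).
  rewrite -/w => /negP[]; apply/eqP; apply: (mulfI (u_neq0 m)).
  by rewrite mulr1 uw -mulrA -exprD subnKC ?(ltnW mn) // -!uw umn.
(* The default value of [nth] supplies the third coordinate 0. *)
pose pt (v : rat * rat) : 'rV[rat]_3 := \row_i nth 0 [:: v.1; v.2] i.
have pt_inj : injective pt.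
  move=> [v1 v2] [v1' v2'] /rowP h; have := h 0; have := h 1.
  by rewrite !mxE /= => -> ->.
pose F := exceptional_set p D `|` (vq_large p D `&` [set X | forall i, `|X 0 i| < 1]).
have F_fin : finite_set F by rewrite finite_setU; split=> //; exact: finite_vq_large.
have uF n : F (pt (u n)).
  have [Zu1 Zu2 uD] := uP n.
  have SP : surface D (pt (u n)).
    apply/(@surfaceE _ D (pt (u n)) 0 1 2%:R) => //.
    by rewrite !mxE /= expr0n /= mulr0 !addr0.
  have ZP : surface_Zinv p D (pt (u n)).
    split=> // i; rewrite mxE; case: i => [[|[|[|//]]] ?] //=; exact: (Zinv_intr p 0).
  have bP i : `|pt (u n) 0 i| < 1.
    rewrite -(@ltr_pXn2r _ 2) ?nnegrE // expr1n real_normK ?num_real // (le_lt_trans _ D1) //.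
    rewrite -uD mxE; case: i => [[|[|[|//]]] ?] /=; rewrite ?expr0n ?addr_ge0 ?sqr_ge0 //.
      by rewrite lerDl sqr_ge0.
    by rewrite lerDr sqr_ge0.
  have [h|/existsNP[i /not_implyP[xi0 /negP]]] :=
    pselect (forall i, pt (u n) 0 i != 0 -> vq p D <= 2 * vq p (pt (u n) 0 i)).
    by right; split; [split|exact: bP].
  rewrite -ltNge => vi; left; split=> //.
    by apply/eqP/prodf_eq0; exists 2%:R => //; rewrite mxE.
  by exists i; rewrite valp_double_lt ?(gt_eqF D0) // xi0.
apply: infinite_nat.
have -> : [set: nat] = (fun n => pt (u n)) @^-1` F by apply/seteqP; split=> n // _; exact: uF.
apply: finite_preimage => // m n _ _ /pt_inj; exact: u_inj.
Qed.

Theorem theorem3 (R : realType) (p : nat) (D : rat)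
    (p_prime : prime p) (p_odd : odd p)
    (D_Zinv : Zinv p D) (D_gt0 : 0 < D) (D_lt1 : D < 1) :
  (exists (N : nat) (P : 'I_N -> 'rV[rat]_3),
    (forall k, surface_Zinv p D (P k)) /\
    (forall Q : 'rV[rat]_3,
      surface_Zinv p D Q ->
      compact_part (ratr D : R) (map_mx ratr Q) ->
      (forall k, Q <> P k) ->
      (exists k, Gamma_orbit (P k) Q) \/
      (exists2 X, exceptional_set p D X & Gamma_orbit X Q))) /\
  ((p = 1 %[mod 4])%N /\ (exists x0 y0 : rat,
       [/\ Zinv p x0, Zinv p y0 & x0 ^+ 2 + y0 ^+ 2 = D]) ->
     infinite_set (exceptional_set p D)) /\
  (~ ((p = 1 %[mod 4])%N /\ (exists x0 y0 : rat,
       [/\ Zinv p x0, Zinv p y0 & x0 ^+ 2 + y0 ^+ 2 = D])) ->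
     exceptional_set p D = set0).
Proof.
split; last first.
  split=> [[p4 xy]|nxy]; first exact: exceptional_infinite.
  by apply/seteqP; split=> // X /(exceptional_mod4 p_prime p_odd D_gt0).
(* The points P_i are the stopping points, listed by [s]. *)
have /finite_seqP[s sE] := finite_vq_large D p_prime.
have sP X : X \in s -> (vq_large p D `&` [set X | forall i, `|X 0 i| < 1]) X.
  by rewrite sE.
exists (size s), (fun k => nth 0 s k); split=> [k|Q ZQ cQ _].
  by have [[]] := sP _ (mem_nth 0 (ltn_ord k)).
have bQ i : `|Q 0 i| < 2.
  have /compact_part_lt2 - /(_ i) := cQ; rewrite mxE => h.
  rewrite -(ltr_rat R) ratr_norm ratr_nat; apply: h.
  by rewrite -(ratr_nat R 4) ltr_rat (lt_trans D_lt1).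
have [n vQ] : exists n : nat, forall i, vq_ge p (- n%:Z) (Q 0 i).
  have /choice[f fP] : forall i, exists n : nat, vq_ge p (- n%:Z) (Q 0 i).
    by move=> i; apply: Zinv_pv => //; exact: ZQ.2.
  exists (\max_i f i)%N => i; apply: vq_ge_le (fP i).
  by rewrite lerN2 lez_nat (leq_bigmax i).
have [Y QY [FY|eY]] := descent p_prime D_gt0 D_lt1 ZQ bQ vQ; last by right; exists Y.
have Ys : [set` s] Y by rewrite -sE.
have Yi : (index Y s < size s)%N by rewrite index_mem.
by left; exists (Ordinal Yi); rewrite /= nth_index.
Qed.
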